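(* The LLF-MP scheme $$(\mathbb{I}-\sigma\mathbb{D}_2)\,\delta_t\mathbf{U}^n+\mathbb{D}(\mathbf{U}^n)\,\widehat{\mathbf{U}}^{n}=0,\qquad n\ge 1,$$ is uniquely solvable: for every $n\ge1$ and all given $\mathbf{U}^{n-1},\mathbf{U}^n\in\mathbb{R}^N$ there is exactly one $\mathbf{U}^{n+1}\in\mathbb{R}^N$ satisfying this equation.
   Context: Constants: $a,\sigma,\gamma>0$. $N$ is a positive even integer, $L=x_R-x_L>0$, $h=L/N$, $x_j=x_L+jh$ for $0\le j\le N-1$, $\mu=2\pi/L$; $\tau>0$ is the time step. Fourier differentiation matrices: $g_j(x)=\frac1N\sum_{k=-N/2}^{N/2}\frac1{c_k}e^{ik\mu(x-x_j)}$ with $c_k=1$ for $|k|\ne N/2$ and $c_{\pm N/2}=2$; $(\mathbb{D}_k)_{jl}=\frac{d^k g_l}{dx^k}(x_j)$, $0\le j,l\le N-1$. $\mathbb{I}$ is the identity matrix. ($\mathbb{D}_1$ is real antisymmetric, $\mathbb{D}_2$ is real symmetric negative semi-definite.) For a vector $\mathbf{U}$, $\mathbb{D}(\mathbf{U})=a\mathbb{D}_1+\frac{\gamma}{3}\big(\mathrm{diag}(\mathbf{U})\mathbb{D}_1+\mathbb{D}_1\mathrm{diag}(\mathbf{U})\big)$. Time notation: $\delta_t\mathbf{U}^n=\frac{\mathbf{U}^{n+1}-\mathbf{U}^{n-1}}{2\tau}$, $\widehat{\mathbf{U}}^{n}=\frac{\mathbf{U}^{n+1}+\mathbf{U}^{n-1}}{2}$.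 *)

(* Defs.v *)
From HB Require Import structures.
From mathcomp Require Import all_boot all_order all_algebra.
From mathcomp Require Import complex.
From mathcomp Require Import all_classical all_reals all_analysis.

Set Implicit Arguments.
Unset Strict Implicit.
Unset Printing Implicit Defensive.

Import Order.TTheory GRing.Theory Num.Theory.
Import numFieldNormedType.Exports.

Local Open Scope ring_scope.
Local Open Scope complex_scope.

Section FourierDifferentiation.
Variables (R : realType) (N : nat) (xL xR : R).

Definition grid_step : R := (xR - xL) / N%:R.

Definition grid_point (j : 'I_N) : R := xL + j%:R * grid_step.

Definition wavenumber : R := 2 * pi / (xR - xL).

(* e^{i t} for real t, by Euler's formula *)
Definition cexpi (t : R) : R[i] := cos t +i* sin t.

Definition c_coef (k : int) : R[i] := if `|k|%N == N./2 then 2 else 1.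

(* The frequency k = -N/2, ..., N/2 is m - N/2 with m = 0, ..., N (N even). *)
Definition trig_basis (j : 'I_N) (x : R) : R[i] :=
  N%:R^-1 * \sum_(m < N.+1)
    let k : int := m%:Z - (N./2)%:Z in
    (c_coef k)^-1 * cexpi (k%:~R * wavenumber * (x - grid_point j)).

(* k-th derivative of a complex-valued function of a real variable; R[i] has
   no normed R-module structure in the libraries, so it is taken on the real
   and imaginary parts. *)
Definition cderive1n (k : nat) (f : R -> R[i]) (x : R) : R[i] :=
  derive1n k (fun y => complex.Re (f y)) x
  +i* derive1n k (fun y => complex.Im (f y)) x.

(* Complex entries; they are in fact real. *)
Definition diff_mx (k : nat) : 'M[R[i]]_N :=
  \matrix_(j, l) cderive1n k (trig_basis l) (grid_point j).

End FourierDifferentiation.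

Section Scheme.
Variables (R : realType) (N : nat) (xL xR a sigma gamma tau : R).

Definition to_complex m n (A : 'M[R]_(m, n)) : 'M[R[i]]_(m, n) :=
  map_mx (real_complex R) A.

Definition conv_mx (U : 'cV[R]_N) : 'M[R[i]]_N :=
  let D1 := diff_mx N xL xR 1%N in
  let dU := diag_mx (to_complex U)^T in
  a%:C *: D1 + (gamma / 3)%:C *: (dU *m D1 + D1 *m dU).

Definition delta_t (U : nat -> 'cV[R]_N) (n : nat) : 'cV[R]_N :=
  (2 * tau)^-1 *: (U n.+1 - U n.-1).

Definition time_avg (U : nat -> 'cV[R]_N) (n : nat) : 'cV[R]_N :=
  2^-1 *: (U n.+1 + U n.-1).

Definition LLF_MP_at (U : nat -> 'cV[R]_N) (n : nat) : Prop :=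
  (1%:M - sigma%:C *: diff_mx N xL xR 2%N) *m to_complex (delta_t U n)
  + conv_mx (U n) *m to_complex (time_avg U n) = 0.

End Scheme.

(* Main.v *)
Require Import Defs.
From mathcomp Require Import all_boot all_order all_algebra.
From mathcomp Require Import complex ring.
From mathcomp Require Import all_classical all_reals all_analysis.

Set Implicit Arguments.
Unset Strict Implicit.
Unset Printing Implicit Defensive.

Import Order.TTheory GRing.Theory Num.Theory.
Import numFieldNormedType.Exports.

Local Open Scope ring_scope.
Local Open Scope complex_scope.

(** The scheme is linear in the unknown, so it amounts to a square system whose
    matrix is (2 tau)^-1 (I - sigma D_2) + D(U^n) / 2, and the theorem is the
    invertibility of that matrix. An energy argument gives it: the quadratic
    form of the matrix is positive off 0 (lemma scheme_unitmx). The form of D(U)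
    vanishes because D(U) inherits the antisymmetry of D_1, whatever U is, and
    I - sigma D_2 is at least the identity because - D_2 is positive
    semi-definite.

    The two facts on the differentiation matrices come from the Fourier series.
    In the sum that defines g_l the frequencies k and - k carry the same weight,
    so the imaginary part cancels and g_l (x) is a sum of terms
    w_k cos (k mu (x - x_l)) with w_k >= 0 (lemma trig_basis_real). One derivative
    gives a sum of sines, an odd function of x_j - x_l, hence antisymmetry. Two
    derivatives give minus a cosine sum with weights w_k (k mu)^2 >= 0, whose
    quadratic form is a combination of squares (lemma qform_cos_sum_ge0). Being
    real, these matrices turn the complex equation of the scheme into a real
    one (lemma LLF_MP_at_real). *)

(** * Quadratic forms of real matrices *)

Definition qform (R : realFieldType) (N : nat) (A : 'M[R]_N) (v : 'rV[R]_N) : R :=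
  (v *m A *m v^T) 0 0.

Lemma qformD (R : realFieldType) (N : nat) (A B : 'M[R]_N) (v : 'rV[R]_N) :
  qform (A + B) v = qform A v + qform B v.
Proof. by rewrite /qform mulmxDr mulmxDl mxE. Qed.

Lemma qformZ (R : realFieldType) (N : nat) (c : R) (A : 'M[R]_N) (v : 'rV[R]_N) :
  qform (c *: A) v = c * qform A v.
Proof. by rewrite /qform -scalemxAr -scalemxAl mxE. Qed.

Lemma qform_sum (R : realFieldType) (N : nat) (A : 'M[R]_N) (v : 'rV[R]_N) :
  qform A v = \sum_j \sum_l v 0 j * v 0 l * A j l.
Proof.
rewrite /qform -mulmxA mxE; apply: eq_bigr => j _.
rewrite mxE mulr_sumr; apply: eq_bigr => l _; rewrite !mxE; ring.
Qed.

Lemma qform1_gt0 (R : realFieldType) (N : nat) (v : 'rV[R]_N) :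
  v != 0 -> 0 < qform 1%:M v.
Proof.
move=> /rV0Pn[i vi]; rewrite /qform mulmx1 mxE (bigD1 i) //=.
have sq j : v 0 j * v^T j 0 = v 0 j ^+ 2 by rewrite mxE expr2.
rewrite sq ltr_pwDl ?exprn_even_gt0 //.
by apply: sumr_ge0 => j _; rewrite sq sqr_ge0.
Qed.

(** A scalar equals its transpose, so the form takes opposite values on A and
    on its transpose -A. *)
Lemma qform_antisym (R : realFieldType) (N : nat) (A : 'M[R]_N) (v : 'rV[R]_N) :
  A^T = - A -> qform A v = 0.
Proof.
move=> AT; have : qform A v = - qform A v.
  have -> : - qform A v = (v *m A^T *m v^T) 0 0.
    by rewrite AT mulmxN mulNmx [RHS]mxE.
  have -> : v *m A^T *m v^T = (v *m A *m v^T)^T.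
    by rewrite !trmx_mul trmxK mulmxA.
  by rewrite mxE.
by move/esym/eqP; rewrite eqNr => /eqP.
Qed.

(** A vector of the kernel of A annihilates the form, hence is zero. *)
Lemma qform_gt0_unitmx (R : realFieldType) (N : nat) (A : 'M[R]_N) :
  (forall v, v != 0 -> 0 < qform A v) -> A \in unitmx.
Proof.
move=> Apos; rewrite -row_free_unit; apply: inj_row_free => v vA.
apply/eqP; apply: contraT => /Apos.
by rewrite /qform vA mul0mx mxE ltxx.
Qed.

Lemma conv_antisym (R : realFieldType) (N : nat) (a c : R) (D : 'M[R]_N)
    (d : 'rV[R]_N) : D^T = - D ->
  (a *: D + c *: (diag_mx d *m D + D *m diag_mx d))^T
    = - (a *: D + c *: (diag_mx d *m D + D *m diag_mx d)).
Proof.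
move=> DT; rewrite linearD !linearZ /= linearD /= !trmx_mul tr_diag_mx DT.
by rewrite mulmxN mulNmx opprD -!scalerN opprD; congr (_ + _ *: _); rewrite addrC.
Qed.

(** * Trigonometric sums *)

Definition cos_sum (R : realType) (n : nat) (w th : 'I_n -> R) (y : R) : R :=
  \sum_(m < n) w m * cos (th m * y).

Definition sin_sum (R : realType) (n : nat) (w th : 'I_n -> R) (y : R) : R :=
  \sum_(m < n) w m * sin (th m * y).

Lemma is_derive_affine (R : realType) (t c x : R) :
  is_derive x 1 (fun y : R => t * (y - c)) t.
Proof.
have -> : (fun y : R => t * (y - c)) = t \*: (id - cst c) by [].
apply: is_derive_eq.
by rewrite subr0 /GRing.scale /= mulr1.
Qed.

Lemma derive1_cos_sum (R : realType) (n : nat) (w th : 'I_n -> R) (c : R) :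
  (fun y => cos_sum w th (y - c))^`()%classic
  = (fun y => sin_sum (fun m => - (w m * th m)) th (y - c)).
Proof.
apply/funext => x; rewrite derive1E /cos_sum /sin_sum.
have -> : (fun y => \sum_(m < n) w m * cos (th m * (y - c)))
    = \sum_(m < n) (w m \*: (cos \o (fun y => th m * (y - c)))).
  by apply/funext => y; rewrite fct_sumE.
apply: derive_val; apply: is_derive_sum => m.
have comp : is_derive x 1 (cos \o (fun y => th m * (y - c)))
    (- sin (th m * (x - c)) * th m) by exact/is_derive1_comp/is_derive_affine.
apply: is_derive_eq.
rewrite /GRing.scale /=; ring.
Qed.

Lemma derive1_sin_sum (R : realType) (n : nat) (w th : 'I_n -> R) (c : R) :
  (fun y => sin_sum w th (y - c))^`()%classic
  = (fun y => cos_sum (fun m => w m * th m) th (y - c)).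
Proof.
apply/funext => x; rewrite derive1E /cos_sum /sin_sum.
have -> : (fun y => \sum_(m < n) w m * sin (th m * (y - c)))
    = \sum_(m < n) (w m \*: (sin \o (fun y => th m * (y - c)))).
  by apply/funext => y; rewrite fct_sumE.
apply: derive_val; apply: is_derive_sum => m.
have comp : is_derive x 1 (sin \o (fun y => th m * (y - c)))
    (cos (th m * (x - c)) * th m) by exact/is_derive1_comp/is_derive_affine.
apply: is_derive_eq.
rewrite /GRing.scale /=; ring.
Qed.

Lemma sin_sumN (R : realType) (n : nat) (w th : 'I_n -> R) (y : R) :
  sin_sum w th (- y) = - sin_sum w th y.
Proof.
by rewrite /sin_sum -sumrN; apply: eq_bigr => m _; rewrite mulrN sinN mulrN.
Qed.

(** The hypotheses say that the frequencies of indices m and n - 1 - m are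
    opposite and have the same weight, so their sine terms cancel. *)
Lemma sin_sum_sym0 (R : realType) (n : nat) (w th : 'I_n -> R) (y : R) :
  (forall m, w (rev_ord m) = w m) -> (forall m, th (rev_ord m) = - th m) ->
  sin_sum w th y = 0.
Proof.
move=> wS thS; have : sin_sum w th y = - sin_sum w th y.
  rewrite {1}/sin_sum (reindex_inj rev_ord_inj) /= -sumrN.
  by apply: eq_bigr => m _; rewrite wS thS mulNr sinN mulrN.
by move/esym/eqP; rewrite eqNr => /eqP.
Qed.

(** The addition formula for the cosine splits the form into a combination of
    squares: a cosine sum with nonnegative coefficients is a positive-definite
    function in the sense of Bochner. *)
Lemma qform_cos_sum_ge0 (R : realType) (N n : nat) (w th : 'I_n -> R)
    (x : 'I_N -> R) (v : 'rV[R]_N) : (forall m, 0 <= w m) ->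
  0 <= qform (\matrix_(j, l) cos_sum w th (x j - x l)) v.
Proof.
move=> w_ge0; rewrite qform_sum.
have -> : \sum_j \sum_l v 0 j * v 0 l
      * (\matrix_(j, l) cos_sum w th (x j - x l)) j l
    = \sum_m w m * ((\sum_j v 0 j * cos (th m * x j)) ^+ 2
                    + (\sum_j v 0 j * sin (th m * x j)) ^+ 2).
  under eq_bigr => j _ do under eq_bigr => l _ do rewrite mxE /cos_sum mulr_sumr.
  under eq_bigr => j _ do rewrite exchange_big.
  rewrite exchange_big; apply: eq_bigr => m _ /=.
  rewrite !expr2 !mulr_suml -big_split mulr_sumr /=; apply: eq_bigr => j _.
  rewrite !mulr_sumr -big_split mulr_sumr /=; apply: eq_bigr => l _.
  rewrite mulrBr cosB; ring.
by apply: sumr_ge0 => m _; rewrite mulr_ge0 // addr_ge0 // sqr_ge0.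
Qed.

(** * The Fourier differentiation matrices *)

Definition fourier_weight (R : realType) (N : nat) (m : 'I_N.+1) : R :=
  N%:R^-1 * (if `|m%:Z - (N./2)%:Z|%N == N./2 then 2^-1 else 1).

Definition fourier_freq (R : realType) (N : nat) (xL xR : R) (m : 'I_N.+1) : R :=
  (m%:Z - (N./2)%:Z)%:~R * wavenumber xL xR.

Lemma centered_rev_ord (N : nat) (m : 'I_N.+1) : ~~ odd N ->
  (rev_ord m)%:Z - (N./2)%:Z = - (m%:Z - (N./2)%:Z).
Proof.
move=> N_even; have mN : (m <= N)%N by rewrite -ltnS.
rewrite /= subSS -subzn //.
have -> : N%:Z = (N./2)%:Z + (N./2)%:Z.
  by rewrite -PoszD addnn even_halfK.
ring.
Qed.

Lemma fourier_weight_rev (R : realType) (N : nat) (m : 'I_N.+1) : ~~ odd N ->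
  fourier_weight R (rev_ord m) = fourier_weight R m.
Proof. by move=> N_even; rewrite /fourier_weight centered_rev_ord // abszN. Qed.

Lemma fourier_weight_ge0 (R : realType) (N : nat) (m : 'I_N.+1) :
  0 <= fourier_weight R m.
Proof.
by rewrite mulr_ge0 ?invr_ge0 ?ler0n //; case: ifP; rewrite ?invr_ge0 ?ler0n.
Qed.

Lemma fourier_freq_rev (R : realType) (N : nat) (xL xR : R) (m : 'I_N.+1) :
  ~~ odd N -> fourier_freq xL xR (rev_ord m) = - fourier_freq xL xR m.
Proof.
by move=> N_even; rewrite /fourier_freq centered_rev_ord // rmorphN mulNr.
Qed.

Lemma sum_complex (R : realType) (n : nat) (f g : 'I_n -> R) :
  \sum_(m < n) (f m +i* g m) = (\sum_(m < n) f m) +i* (\sum_(m < n) g m).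
Proof. by elim/big_rec3: _ => [//|m x y z _ ->]. Qed.

Lemma mul_real_complex (R : realType) (r p q : R) :
  r%:C * (p +i* q) = (r * p) +i* (r * q).
Proof. by apply/eqP; rewrite eq_complex /= !mul0r subr0 addr0 !eqxx. Qed.

(** The two summands of frequencies k and -k are conjugate to each other, which
    makes the sum real. *)
Lemma trig_basis_real (R : realType) (N : nat) (xL xR : R) (l : 'I_N) (y : R) :
  ~~ odd N ->
  trig_basis xL xR l y
  = (cos_sum (@fourier_weight R N) (@fourier_freq R N xL xR)
       (y - grid_point xL xR l))%:C.
Proof.
move=> N_even; rewrite /trig_basis mulr_sumr.
have E (m : 'I_N.+1) : N%:R^-1 * ((c_coef R N (m%:Z - (N./2)%:Z))^-1
      * cexpi ((m%:Z - (N./2)%:Z)%:~R * wavenumber xL xR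
               * (y - grid_point xL xR l)))
    = (fourier_weight R m * cos (fourier_freq xL xR m * (y - grid_point xL xR l)))
      +i* (fourier_weight R m
           * sin (fourier_freq xL xR m * (y - grid_point xL xR l))) :> R[i].
  have -> : N%:R^-1 * ((c_coef R N (m%:Z - (N./2)%:Z))^-1 * cexpi
      ((m%:Z - (N./2)%:Z)%:~R * wavenumber xL xR * (y - grid_point xL xR l)))
    = (fourier_weight R m)%:C
      * cexpi (fourier_freq xL xR m * (y - grid_point xL xR l)) :> R[i].
    rewrite mulrA /fourier_weight /c_coef; congr (_ * _).
    rewrite rmorphM fmorphV rmorph_nat; congr (_ * _).
    by case: ifP => _; rewrite ?fmorphV ?rmorph_nat ?invr1 ?rmorph1.
  exact: mul_real_complex.
under eq_bigr => m _ do rewrite E.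
rewrite sum_complex -/(cos_sum _ _ _) -/(sin_sum _ _ _); congr (_ +i* _).
by apply: sin_sum_sym0 => m; rewrite ?fourier_weight_rev ?fourier_freq_rev.
Qed.

Definition D1_real (R : realType) (N : nat) (xL xR : R) : 'M[R]_N :=
  \matrix_(j, l) sin_sum
    (fun m => - (fourier_weight R m * fourier_freq xL xR m))
    (@fourier_freq R N xL xR) (grid_point xL xR j - grid_point xL xR l).

(** Encoded as -D_2, so that all its Fourier coefficients are nonnegative. *)
Definition negD2_real (R : realType) (N : nat) (xL xR : R) : 'M[R]_N :=
  \matrix_(j, l) cos_sum
    (fun m => fourier_weight R m * fourier_freq xL xR m ^+ 2)
    (@fourier_freq R N xL xR) (grid_point xL xR j - grid_point xL xR l).

(** Reality of the basis functions passes to every derivative, as those are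
    taken on the real and imaginary parts separately. *)
Lemma diff_mx_real (R : realType) (N k : nat) (xL xR : R) : ~~ odd N ->
  diff_mx N xL xR k = to_complex (\matrix_(j, l)
    derive1n k (fun y => cos_sum (@fourier_weight R N) (@fourier_freq R N xL xR)
       (y - grid_point xL xR l)) (grid_point xL xR j)).
Proof.
move=> N_even; apply/matrixP => j l; rewrite !mxE /cderive1n.
under [X in derive1n k X]eq_fun do rewrite trig_basis_real //.
under [X in _ +i* derive1n k X _]eq_fun do rewrite trig_basis_real //.
congr (_ +i* _) => /=.
elim: k => [//|k]; rewrite !derive1nS => IH.
have z : forall k, derive1n k (fun=> 0 : R) = (fun=> 0 : R).
  by elim=> [//|i]; rewrite derive1nS => ->; apply/funext => x; exact: derive1_cst.
by rewrite z; exact: derive1_cst.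
Qed.

Lemma diff_mx1 (R : realType) (N : nat) (xL xR : R) : ~~ odd N ->
  diff_mx N xL xR 1 = to_complex (D1_real N xL xR).
Proof.
move=> N_even; rewrite diff_mx_real //; congr to_complex.
by apply/matrixP => j l; rewrite !mxE derive1n1 derive1_cos_sum.
Qed.

Lemma diff_mx2 (R : realType) (N : nat) (xL xR : R) : ~~ odd N ->
  diff_mx N xL xR 2 = to_complex (- negD2_real N xL xR).
Proof.
move=> N_even; rewrite diff_mx_real //; congr to_complex.
apply/matrixP => j l; rewrite !mxE derive1nS derive1n1.
rewrite derive1_cos_sum derive1_sin_sum /cos_sum -sumrN.
by apply: eq_bigr => m _; ring.
Qed.

Lemma D1_real_antisym (R : realType) (N : nat) (xL xR : R) :
  (D1_real N xL xR)^T = - D1_real N xL xR.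
Proof. by apply/matrixP => j l; rewrite !mxE -sin_sumN opprB. Qed.

Lemma negD2_real_psd (R : realType) (N : nat) (xL xR : R) (v : 'rV[R]_N) :
  0 <= qform (negD2_real N xL xR) v.
Proof.
apply: qform_cos_sum_ge0 => m.
by rewrite mulr_ge0 ?fourier_weight_ge0 ?sqr_ge0.
Qed.

(** * The scheme as a real linear system *)

Definition conv_real (R : realType) (N : nat) (xL xR a gamma : R)
    (u : 'cV[R]_N) : 'M[R]_N :=
  a *: D1_real N xL xR + (gamma / 3) *:
    (diag_mx u^T *m D1_real N xL xR + D1_real N xL xR *m diag_mx u^T).

Definition mass_real (R : realType) (N : nat) (xL xR sigma : R) : 'M[R]_N :=
  1%:M + sigma *: negD2_real N xL xR.

(** All matrices of the complex equation are images of real ones, and the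
    embedding of the reals into the complex numbers is an injective morphism. *)
Lemma LLF_MP_at_real (R : realType) (N : nat) (xL xR a sigma gamma tau : R)
    (U : nat -> 'cV[R]_N) (n : nat) : ~~ odd N ->
  LLF_MP_at xL xR a sigma gamma tau U n <->
  mass_real N xL xR sigma *m delta_t tau U n
  + conv_real xL xR a gamma (U n) *m time_avg U n = 0.
Proof.
move=> N_even; rewrite /LLF_MP_at /conv_mx diff_mx1 // diff_mx2 //.
set lhs := (X in X = 0 <-> _); set rhs := (X in _ <-> X = 0).
have -> : lhs = to_complex rhs.
  rewrite /lhs /rhs /to_complex /mass_real /conv_real.
  rewrite !(map_mxD, map_mxM, map_mxZ, map_diag_mx, map_trmx, map_mxN, map_mx1).
  by rewrite scalerN opprK.
rewrite /to_complex; split=> [|->]; last exact: map_mx0.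
by rewrite -(map_mx0 (real_complex R)) => /map_mx_inj.
Qed.

(** Separates the unknown time level V from the known one W in a combination of
    a centered difference and a centered average. *)
Lemma implicit_explicit_split (R : realType) (N : nat) (M K : 'M[R]_N) (s t : R)
    (V W : 'cV[R]_N) :
  M *m (s *: (V - W)) + K *m (t *: (V + W))
  = (s *: M + t *: K) *m V - (s *: M - t *: K) *m W.
Proof.
rewrite -!scalemxAr mulmxBr mulmxDr mulmxDl mulmxBl -!scalemxAl.
by rewrite scalerBr scalerDr opprB addrACA [X in _ + X]addrC.
Qed.

(** The convective part does not contribute to the form, and the mass part is
    at least the identity. *)
Lemma scheme_unitmx (R : realType) (N : nat) (xL xR a sigma gamma tau : R)
    (u : 'cV[R]_N) : 0 < sigma -> 0 < tau ->
  (2 * tau)^-1 *: mass_real N xL xR sigma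
    + 2^-1 *: conv_real xL xR a gamma u \in unitmx.
Proof.
move=> sigma_gt0 tau_gt0; apply: qform_gt0_unitmx => v v_neq0.
rewrite qformD !qformZ (@qform_antisym _ _ (conv_real _ _ _ _ _)); last first.
  exact/conv_antisym/D1_real_antisym.
rewrite mulr0 addr0 mulr_gt0 ?invr_gt0 ?mulr_gt0 //.
rewrite qformD qformZ ltr_pwDl ?qform1_gt0 //.
by rewrite mulr_ge0 ?(ltW sigma_gt0) ?negD2_real_psd.
Qed.

(* Only the values of U at n-1 and n matter: its value at n+1 is overridden by
   the unknown V. *)
Theorem theorem3p4 (R : realType) (N : nat) (xL xR a sigma gamma tau : R)
    (N_gt0 : (0 < N)%N) (N_even : ~~ odd N) (xLR : xL < xR)
    (a_gt0 : 0 < a) (sigma_gt0 : 0 < sigma) (gamma_gt0 : 0 < gamma)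
    (tau_gt0 : 0 < tau) (U : nat -> 'cV[R]_N) (n : nat) (n_ge1 : (1 <= n)%N) :
  exists! V : 'cV[R]_N,
    LLF_MP_at xL xR a sigma gamma tau [eta U with n.+1 |-> V] n.
Proof.
set M := mass_real N xL xR sigma.
set K := conv_real xL xR a gamma (U n).
pose A := (2 * tau)^-1 *: M + 2^-1 *: K.
pose b := ((2 * tau)^-1 *: M - 2^-1 *: K) *m U n.-1.
have AU : A \in unitmx by exact: scheme_unitmx.
have E V : LLF_MP_at xL xR a sigma gamma tau [eta U with n.+1 |-> V] n
           <-> A *m V = b.
  rewrite LLF_MP_at_real // /delta_t /time_avg /= eqxx.
  rewrite (ltn_eqF (ltnSn n)) (ltn_eqF (leq_ltn_trans (leq_pred n) (ltnSn n))).
  rewrite -/M -/K.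
  rewrite implicit_explicit_split -/A -/b.
  by split=> [/eqP|->]; rewrite ?subrr // subr_eq0 => /eqP.
exists (invmx A *m b); split; first by apply/E; rewrite mulKVmx.
by move=> V /E <-; rewrite mulKmx.
Qed.
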